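(* Let $X$ be a topological space, $\mathcal F$ a family of nonempty subsets of $X$, $\lambda$ a singular cardinal, and $(\lambda_\beta)_{\beta\in\operatorname{cf}\lambda}$ a sequence of infinite cardinals $<\lambda$ such that $\sup_{\beta\in\operatorname{cf}\lambda}\lambda_\beta=\lambda$. If $X$ satisfies $\mathrm{CAP}_{\operatorname{cf}\lambda}$, and $X$ satisfies $\mathcal F$-$\mathrm{CAP}_{\lambda_\beta}$ for every $\beta\in\operatorname{cf}\lambda$, then $X$ satisfies $\mathcal F$-$\mathrm{CAP}^*_\lambda$. In particular, if $X$ satisfies $\mathrm{CAP}_{\operatorname{cf}\lambda}$, and $\mathrm{CAP}_{\lambda_\beta}$ for every $\beta\in\operatorname{cf}\lambda$, then $X$ satisfies $\mathrm{CAP}^*_\lambda$.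
   Context: No separation axioms are assumed. For an infinite cardinal $\nu$ and a sequence $(Y_\alpha)_{\alpha\in\nu}$ of subsets of $X$, a point $x\in X$ is a $\nu$-complete accumulation point of the sequence if $|\{\alpha\in\nu\mid Y_\alpha\cap U\neq\emptyset\}|=\nu$ for every neighborhood $U$ of $x$ in $X$. $X$ satisfies $\mathcal F$-$\mathrm{CAP}^*_\nu$ if every sequence $(F_\alpha)_{\alpha\in\nu}$ of (not necessarily distinct) members of $\mathcal F$ has a $\nu$-complete accumulation point in $X$. $X$ satisfies $\mathcal F$-$\mathrm{CAP}_\nu$ if every sequence $(F_\alpha)_{\alpha\in\nu}$ of pairwise distinct members of $\mathcal F$ has a $\nu$-complete accumulation point in $X$. $X$ satisfies $\mathrm{CAP}_\nu$ if every subset $Y\subseteq X$ with $|Y|=\nu$ has a complete accumulation point, i.e., a point $x\in X$ such that $|Y\cap U|=|Y|$ for every neighborhood $U$ of $x$; this is $\mathcal F$-$\mathrm{CAP}_\nu$ for $\mathcal F$ the family of all singletons of $X$. $\mathrm{CAP}^*_\nu$ denotes $\mathcal F$-$\mathrm{CAP}^*_\nu$ for $\mathcal F$ the family of all singletons of $X$. *)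

(* Defs.v *)
From mathcomp Require Import all_boot all_order.
From mathcomp Require Import boolp classical_sets functions wochoice cardinality.
From mathcomp Require Import topology.

Set Implicit Arguments.
Unset Strict Implicit.
Unset Printing Implicit Defensive.

Local Open Scope classical_set_scope.
Local Open Scope card_scope.

(* Cardinals are initial ordinals: a well-ordered type none of whose proper
   initial segments [{b | b < a}] has the cardinality of the whole type. The
   elements of [nu] are thus the ordinals below the cardinal it represents, so
   that a [nu]-sequence is a function on [nu]. Each cardinal has many isomorphic
   representatives; statements about cardinals quantify over all of them.
   As [ord_le] is total, [~~ ord_le a b] says that [b < a]. *)
Record cardinal : Type := Cardinal {
  ord_below :> Type;
  ord_le : rel ord_below;
  ord_le_wo : wochoice.well_order ord_le;
  ord_initial : forall a : ord_below,
    ~ ([set: ord_below] #<= [set b | ~~ ord_le a b])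
}.

Arguments ord_le {c} _ _.

Definition cardinal_le (kappa nu : cardinal) : Prop :=
  [set: kappa] #<= [set: nu].

Definition cardinal_lt (kappa nu : cardinal) : Prop :=
  cardinal_le kappa nu /\ ~ cardinal_le nu kappa.

Definition infinite_cardinal (nu : cardinal) : Prop :=
  infinite_set [set: nu].

Definition is_cardinal_sup (I : Type) (nu : I -> cardinal) (lambda : cardinal)
    : Prop :=
  (forall i, cardinal_le (nu i) lambda) /\
  (forall mu : cardinal,
      (forall i, cardinal_le (nu i) mu) -> cardinal_le lambda mu).

Definition cofinal (nu : cardinal) (S : set nu) : Prop :=
  forall a : nu, exists2 s, S s & ord_le a s.

(* [kappa] is (a representative of) cf [nu]. *)
Definition is_cf (kappa nu : cardinal) : Prop :=
  (exists2 S : set nu, cofinal S & S #= [set: kappa]) /\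
  (forall S : set nu, cofinal S -> [set: kappa] #<= S).

Definition singular_cardinal (nu : cardinal) : Prop :=
  infinite_cardinal nu /\
  exists2 kappa : cardinal, is_cf kappa nu & cardinal_lt kappa nu.

Section CompleteAccumulation.
Variable X : topologicalType.

Definition seq_complete_accumulation_point (nu : cardinal) (Y : nu -> set X)
    (x : X) : Prop :=
  forall U : set X, nbhs x U ->
    [set a : nu | (Y a `&` U) !=set0] #= [set: nu].

Definition complete_accumulation_point (Y : set X) (x : X) : Prop :=
  forall U : set X, nbhs x U -> (Y `&` U) #= Y.

Definition family_CAP_star (F : set (set X)) (nu : cardinal) : Prop :=
  forall Y : nu -> set X, (forall a, F (Y a)) ->
    exists x : X, seq_complete_accumulation_point Y x.

Definition family_CAP (F : set (set X)) (nu : cardinal) : Prop :=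
  forall Y : nu -> set X, injective Y -> (forall a, F (Y a)) ->
    exists x : X, seq_complete_accumulation_point Y x.

Definition CAP (nu : cardinal) : Prop :=
  forall Y : set X, Y #= [set: nu] ->
    exists x : X, complete_accumulation_point Y x.

Definition CAP_star (nu : cardinal) : Prop :=
  family_CAP_star (range (@set1 X)) nu.

End CompleteAccumulation.

(* Main.v *)
Require Import Defs.
From mathcomp Require Import all_boot all_order.
From mathcomp Require Import boolp classical_sets functions wochoice.
From mathcomp Require Import cardinality.
From mathcomp Require Import topology.

(* Every [b] in cf lambda has a point [x_ b] each neighbourhood of which meets
   at least [lambda_ c] terms of [Y] for all [c <= b]: this uses CAP at a single
   [lambda_ d] dominating these [lambda_ c], which exists because fewer than
   cf lambda cardinals below lambda are bounded below lambda.
   If no point is a lambda-complete accumulation point of [Y], each point has a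
   neighbourhood meeting fewer than lambda terms. Then the points [x_ b] must
   form a set of cardinality cf lambda, as otherwise these numbers of terms
   would be bounded below lambda; a complete accumulation point of that set
   gives a contradiction. *)

Set Implicit Arguments.
Unset Strict Implicit.
Unset Printing Implicit Defensive.

Local Open Scope classical_set_scope.
Local Open Scope card_scope.

(** * Cardinal inequalities through injective relations *)

(* Relations rather than functions, so that [U] may be empty. *)
Lemma card_le_relP {T U : Type} (A : set T) (B : set U) :
  A #<= B <-> exists P : T -> U -> Prop,
    (forall a, A a -> exists2 b, B b & P a b) /\
    (forall a a' b, A a -> A a' -> P a b -> P a' b -> a = a').
Proof.
elim/Ppointed: U => U in B *.
  rewrite emptyE; split=> [/eqP->|[P [PB _]]].
    by exists (fun _ _ => False); split => [a []|a a' b []].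
  by apply/eqP/seteqP; split=> // a /PB[b]; case: (no b).
split=> [/pcard_leP[f]|[P [PB Pinj]]].
  exists (fun a b => f a = b); split=> [a Aa|a a' b Aa Aa' <- /esym].
    by exists (f a) => //; apply: funS.
  by apply: (@inj _ _ A f); rewrite inE.
have /choice[f fP] : forall a, exists b, A a -> B b /\ P a b.
  move=> a; have [/PB[b Bb Pab]|nAa] := pselect (A a); first by exists b.
  by exists point => /nAa.
have fB : set_fun A B f by move=> a /fP[].
have fi : {in A &, injective f}.
  move=> a a' /[!inE] Aa Aa' faa'; apply: (Pinj a a' (f a)) => //.
    by have [] := fP a Aa.
  by rewrite faa'; have [] := fP a' Aa'.
rewrite -(card_le_eql (inj_card_eq fi)).
by apply: subset_card_le => _ [a /fB ? <-].
Qed.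

Lemma card_le_setX {T T' U U' : Type} (A : set T) (A' : set T')
    (B : set U) (B' : set U') :
  A #<= B -> A' #<= B' -> A `*` A' #<= B `*` B'.
Proof.
move=> /card_le_relP[P [PB Pinj]] /card_le_relP[P' [PB' Pinj']].
apply/card_le_relP; exists (fun p q => P p.1 q.1 /\ P' p.2 q.2); split.
  by move=> [x y] [/= /PB[x' ? ?] /PB'[y' ? ?]]; exists (x', y').
move=> [x y] [x1 y1] [x' y'] [/= Ax Ay] [/= Ax1 Ay1] [Px Py] [Px1 Py1].
by rewrite (Pinj x x1 x') // (Pinj' y y1 y').
Qed.

(** * Order properties derived from least elements *)

Section WellOrder.
Variables (T : Type) (R : rel T).
Hypothesis R_wo : wochoice.well_order R.

Lemma well_order_min (A : set T) :
  A !=set0 -> exists2 z, A z & forall x, A x -> R z x.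
Proof.
move=> [x Ax]; have [|z [[/asboolP Az zmin] _]] := @R_wo (fun x => `[< A x >]).
  by exists x; apply/asboolP.
by exists z => // y Ay; apply/zmin/asboolP.
Qed.

Lemma well_order_wf : well_founded (fun x y => ~~ R y x).
Proof.
move=> x; apply: contrapT => nAx.
have [|z nAz zmin] := well_order_min
  (A := fun x => ~ Acc (fun x y => ~~ R y x) x).
  by exists x.
apply: nAz; constructor => y /negP nzy.
by apply: contrapT => nAy; apply/nzy/zmin.
Qed.

Lemma well_order_total x y : R x y \/ R y x.
Proof.
have [|z [->|->] zmin] := well_order_min (A := [set x; y]).
- by exists x; left.
- by left; apply: zmin; right.
- by right; apply: zmin; left.
Qed.

Lemma well_order_ltW x y : ~~ R y x -> R x y.
Proof. by case: (well_order_total x y) => // ->. Qed.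

Lemma well_order_refl x : R x x.
Proof. by case: (well_order_total x x). Qed.

(** Both points are least in [[set x; y]], and [well_order] makes least elements unique. *)
Lemma well_order_antisym x y : R x y -> R y x -> x = y.
Proof.
move=> xy yx; have [|z [_ zuniq]] := @R_wo (fun z => `[< [set x; y] z >]).
  by exists x; apply/asboolP; left.
by rewrite -(zuniq x) ?(zuniq y) //; split;
  try (apply/asboolP; by [left|right]);
  move=> _ /asboolP[]->; rewrite ?well_order_refl.
Qed.

Lemma well_order_trans x y z : R x y -> R y z -> R x z.
Proof.
move=> xy yz; have [|u] := well_order_min
  (A := [set w | [\/ w = x, w = y | w = z]]).
  by exists x; constructor.
move=> uxyz umin.
have [ux uy uz] : [/\ R u x, R u y & R u z].
  by split; apply: umin; constructor.
case: uxyz => eu; subst u => //.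
  by rewrite (well_order_antisym xy ux).
by rewrite -(well_order_antisym yz uy).
Qed.

Lemma well_order_trichotomy x y : [\/ ~~ R y x, x = y | ~~ R x y].
Proof.
have [xy|nxy] := boolP (R x y); last by constructor 3.
have [yx|nyx] := boolP (R y x); last by constructor 1.
by constructor 2; apply: well_order_antisym.
Qed.

End WellOrder.

(** * Injections by transfinite recursion and absorption of a point *)

(* The injection [D -> A] is built by recursion along [lt], picking at each
   step an element of [A] not used so far; it can only stop at some [d] such
   that the elements below [d] already exhaust [A]. *)
Lemma wf_card_le_or {T U : Type} (lt : T -> T -> Prop)
    (D : set T) (A : set U) :
  well_founded lt ->
  (forall x y, [\/ lt x y, x = y | lt y x]) ->
  D #<= A \/ exists2 d, D d & A #<= [set x | D x /\ lt x d].
Proof.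
move=> lt_wf lt_total; elim/Ppointed: U => U in A *.
  have [[d Dd]|/nonemptyPn->] := pselect (D !=set0).
    by right; exists d => //; rewrite emptyE_subdef.
  by left; exact: card_ge0.
(* The default [point] is taken only once [A] is exhausted, which is the second alternative of the
   lemma. *)
pose step x (rec : forall y, lt y x -> U) : U :=
  xget point (A `\` [set u | exists y (yx : lt y x), D y /\ rec y yx = u]).
pose f := Fix lt_wf (fun=> U) step.
have fE x : f x = xget point (A `\` (f @` [set y | D y /\ lt y x])).
  rewrite /f Fix_eq => [|y g h gh].
    rewrite /step; congr (xget _ (_ `\` _)); apply/seteqP; split => u.
      by move=> [y [yx [Dy <-]]]; exists y.
    by move=> [y [Dy yx] <-]; exists y, yx.
  by congr (step _ _); apply: functional_extensionality_dep => z;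
    apply: functional_extensionality_dep => zy; apply: gh.
have [[d [Dd Af]]|full] := pselect (exists d, D d /\
    A `<=` f @` [set y | D y /\ lt y d]).
  right; exists d => //.
  exact: card_le_trans (subset_card_le Af) (card_image_le _ _).
left; have fP d : D d -> (A `\` (f @` [set y | D y /\ lt y d])) (f d).
  move=> Dd; rewrite fE; case: xgetP => [u -> //|noA].
  case: full; exists d; split=> // u Au; apply: contrapT => nu.
  exact: (noA u).
apply/card_le_relP; exists (fun d u => f d = u); split=> [d Dd|].
  by exists (f d) => //; case: (fP d Dd).
move=> d e _ Dd De <- edf; have [de|//|ed] := lt_total d e.
  by case: (fP e De) => _ []; exists d.
by case: (fP d Dd) => _ []; exists e.
Qed.

(** Hilbert's hotel along a sequence [g] in [A]: [x] goes to [g 0], each [g n] to [g n.+1], and the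
    rest stays fixed. Since [x] may itself be some [g n], the last two cases exclude it. *)
Lemma infinite_card_setU1 {T : Type} (A : set T) (x : T) :
  infinite_set A -> (x |` A) #<= A.
Proof.
elim/Ppointed: T => T in A x *; first by rewrite emptyE_subdef.
move=> /infiniteP/pcard_leP[g].
have gA n : A (g n) by apply: funS.
have g_inj : injective g by move=> m n; apply: (@inj _ _ setT g); rewrite inE.
apply/card_le_relP; exists (fun y z => [\/ y = x /\ z = g 0%N,
  y <> x /\ (exists2 n, y = g n & z = g n.+1) |
  [/\ y <> x, (forall n, y <> g n) & z = y]]); split.
  move=> y xAy; have [yx|nyx] := pselect (y = x).
    by exists (g 0%N) => //; constructor 1.
  have [[n yn]|ny] := pselect (exists n, y = g n).
    by exists (g n.+1) => //; constructor 2; split=> //; exists n.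
  exists y; first by case: xAy.
  by constructor 3; split=> // n yn; apply: ny; exists n.
move=> y y' z _ _ [[-> ->]|[_ [n -> ->]]|[_ ny ->]]
  [[-> e]|[_ [m -> e]]|[_ ny' e]] //.
- by have := g_inj _ _ e.
- by case: (ny' 0%N).
- by have := g_inj _ _ e.
- by case: (g_inj _ _ e) => ->.
- by case: (ny' n.+1).
- by case: (ny 0%N).
- by case: (ny m.+1).
Qed.

(** * Lexicographic orders and squares of infinite sets *)

Definition lex {T U : Type} (lt : T -> T -> Prop) (lt' : U -> U -> Prop)
    (p q : T * U) : Prop :=
  lt p.1 q.1 \/ p.1 = q.1 /\ lt' p.2 q.2.

Lemma lex_wf {T U : Type} (lt : T -> T -> Prop) (lt' : U -> U -> Prop) :
  well_founded lt -> well_founded lt' -> well_founded (lex lt lt').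
Proof.
move=> wf wf' [x y]; elim/(well_founded_ind wf): x y => x IHx y.
elim/(well_founded_ind wf'): y => y IHy.
by constructor=> -[x' y'] [/= /IHx|[/= -> /IHy]].
Qed.

Lemma lex_trichotomy {T U : Type} (lt : T -> T -> Prop) (lt' : U -> U -> Prop) :
  (forall x y, [\/ lt x y, x = y | lt y x]) ->
  (forall x y, [\/ lt' x y, x = y | lt' y x]) ->
  forall p q, [\/ lex lt lt' p q, p = q | lex lt lt' q p].
Proof.
move=> tri tri' [x y] [x' y']; have [xx'|->|x'x] := tri x x'.
- by constructor 1; left.
- have [yy'|->|y'y] := tri' y y'.
  + by constructor 1; right.
  + by constructor 2.
  + by constructor 3; right.
- by constructor 3; left.
Qed.

Section InfiniteSquare.
Variables (T : Type) (R : rel T).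
Hypothesis R_wo : wochoice.well_order R.
Let lt (x y : T) : Prop := ~~ R y x.
Let seg (d : T) : set T := [set x | ~~ R d x].

(* Pairs are ordered by their maximum first, so that the pairs below [(a, b)]
   lie in the square of a closed initial segment. *)
Lemma infinite_square_card_le (D : set T) :
  infinite_set D -> (forall d, D d -> ~ (D #<= seg d)) ->
  (forall d, D d -> infinite_set (seg d) -> seg d `*` seg d #<= seg d) ->
  D `*` D #<= D.
Proof.
move=> Dinf Dinit IH.
pose max2 x y := if R x y then y else x.
have max2l x y : R x (max2 x y).
  by rewrite /max2; case: ifP => // _; apply: well_order_refl.
have max2r x y : R y (max2 x y).
  rewrite /max2; case: ifP => [_|xy]; first exact: well_order_refl.
  by have [|//] := well_order_total R_wo x y; rewrite xy.
(* Recording the maximum as first component turns the maximum-first order into a plain lexicographic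
   one. *)
pose E := [set w : T * (T * T) |
  [/\ D w.2.1, D w.2.2 & w.1 = max2 w.2.1 w.2.2]].
have DE : D `*` D #<= E.
  apply/card_le_relP; exists (fun p w => w.2 = p); split=> [[a b] [/= Da Db]|].
    by exists (max2 a b, (a, b)).
  by move=> p p' w _ _ ->.
have lt_wf : well_founded lt by apply: well_order_wf.
have lt_tri : forall x y, [\/ lt x y, x = y | lt y x].
  exact: well_order_trichotomy.
have [ED|[[m [a b]] [/= Da Db mE] Dw]] := wf_card_le_or E D
  (lex_wf lt_wf (lex_wf lt_wf lt_wf))
  (lex_trichotomy lt_tri (lex_trichotomy lt_tri lt_tri)).
  exact: card_le_trans DE ED.
have Dm : D m by rewrite mE /max2; case: ifP.
pose S := m |` seg m.
have DS : D #<= S `*` S.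
  apply: card_le_trans Dw _.
  apply/card_le_relP; exists (fun w p => w.2 = p); split; last first.
    move=> [m1 p1] [m2 p2] p [[/= _ _ ->] _] [[/= _ _ ->] _].
    by move=> /= -> ->.
  move=> [m' [a' b']] [[/= _ _ m'E] ltm]; exists (a', b') => //.
  have Rm' : R m' m.
    case: ltm => [/= lm|[/= -> _]]; last exact: well_order_refl.
    exact: well_order_ltW.
  have RS c : R c m' -> S c.
    move=> cm'; have cm := well_order_trans R_wo cm' Rm'.
    have [e|nmc] := boolP (R m c); [left|by right].
    exact: (well_order_antisym R_wo).
  by split=> /=; apply: RS; rewrite m'E.
(* [D] embeds in the square of [S]. This is finite if [seg m] is; otherwise [S] is no larger than
   [seg m], which absorbs its own square, against [Dinit]. *)
have [Sfin|Sinf] := pselect (finite_set (seg m)).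
  have S_fin : finite_set S.
    by rewrite finite_setU; split=> //; exact: finite_set1.
  by case: Dinf; apply: card_le_finite DS (finite_setX S_fin S_fin).
case: (Dinit m Dm); apply: card_le_trans DS _.
apply: card_le_trans (IH m Dm Sinf).
by apply: card_le_setX; apply: infinite_card_setU1.
Qed.

(** Induction on [d]: either [seg d] embeds in a smaller segment and inherits the bound from it, or
    [d] is an initial ordinal and the previous lemma applies. *)
Lemma infinite_segment_square d :
  infinite_set (seg d) -> seg d `*` seg d #<= seg d.
Proof.
elim/(well_founded_ind (well_order_wf R_wo)): d => d IH dinf.
have [[c cd dc]|nd] := pselect (exists2 c, ~~ R d c & seg d #<= seg c).
  have cinf : infinite_set (seg c).
    by apply: contra_not dinf; apply: card_le_finite.
  have cd_le : seg c #<= seg d.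
    apply: subset_card_le => x xc /=; apply: contra xc => dx.
    apply: (well_order_trans R_wo _ dx).
    exact: well_order_ltW.
  apply: card_le_trans cd_le; apply: card_le_trans (IH c cd cinf).
  exact: card_le_setX.
apply: infinite_square_card_le => // c cd dc.
by apply: nd; exists c.
Qed.

End InfiniteSquare.

(** * Segments, comparison and suprema of cardinals *)

Section Cardinals.
Implicit Types kappa lambda mu : cardinal.

Definition segment {lambda} (a : lambda) : set lambda :=
  [set b | ~~ ord_le a b].

Lemma segment_sub lambda (a b : lambda) :
  ord_le a b -> segment a `<=` segment b.
Proof.
by move=> ab x /=; apply: contra => /(well_order_trans (@ord_le_wo lambda) ab).
Qed.

Lemma cardinal_le_or {U : Type} (A : set U) lambda :
  [set: lambda] #<= A \/ exists a : lambda, A #<= segment a.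
Proof.
have wo := @ord_le_wo lambda.
have [|[a _ Aa]] := wf_card_le_or [set: lambda] A (well_order_wf wo)
  (well_order_trichotomy wo); first by left.
by right; exists a; apply: card_le_trans Aa (subset_card_le _) => x [].
Qed.

Lemma cardinal_le_total {U : Type} (A : set U) lambda :
  [set: lambda] #<= A \/ A #<= [set: lambda].
Proof.
have [|[a Aa]] := cardinal_le_or A lambda; first by left.
by right; apply: card_le_trans Aa (card_leT _).
Qed.

Lemma infinite_cardinal_square mu :
  infinite_cardinal mu -> [set: mu] `*` [set: mu] #<= [set: mu].
Proof.
move=> mu_inf; apply: (infinite_square_card_le (@ord_le_wo mu) mu_inf).
  by move=> d _; apply: ord_initial.
by move=> d _; apply: infinite_segment_square (@ord_le_wo mu) d.
Qed.

(** Take the least [c] whose segment is at least as large as that of [a]. By minimality no proper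
    initial segment of [segment c] is as large, so the restricted order is an initial ordinal. *)
Lemma segment_cardinal lambda (a : lambda) :
  exists mu : cardinal, segment a #= [set: mu].
Proof.
have wo := @ord_le_wo lambda.
have [|c ac cmin] := well_order_min wo (A := [set c | segment a #<= segment c]).
  by exists a; apply: card_lexx.
pose below := {x : lambda | ~~ ord_le c x}.
pose le (x y : below) := ord_le (val x) (val y).
have le_wo : wochoice.well_order le.
  move=> A [x Ax]; have [|_ [z Az <-] zmin] :=
    well_order_min wo (A := val @` [set` A]); first by exists (val x), x.
  exists z; split=> [|w [Aw wmin]].
    by split=> // y Ay; apply: zmin; exists y.
  apply: val_inj; apply: (well_order_antisym wo); last exact: wmin.
  by apply: zmin; exists w.
have belowE : [set: below] #= segment c.
  have <- : val @` [set: below] = segment c.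
    apply/seteqP; split=> [_ [x _ <-]|x xc]; first exact: (valP x).
    by exists (exist _ x xc).
  by rewrite card_eq_sym; apply: inj_card_eq => x y _ _; apply: val_inj.
have le_initial (x : below) : ~ ([set: below] #<= [set y | ~~ le x y]).
  move=> lex; have /negP := valP x; apply; apply: cmin => /=.
  apply: card_le_trans ac _; rewrite -(card_le_eql belowE).
  apply: card_le_trans lex _.
  apply/card_le_relP; exists (fun y z => val y = z); split=> [y xy|].
    by exists (val y).
  by move=> y y' _ _ _ <- /val_inj.
exists (Cardinal le_wo le_initial).
rewrite /= (card_eqr belowE) card_eq_le ac /=.
by apply: subset_card_le; apply: segment_sub; apply: cmin; apply: card_lexx.
Qed.

(** The supremum is least only among cardinals, whereas [A] is any set. If [lambda] did not embed in
    [A], then [A] would fit in a segment, whose cardinal would be an upper bound below [lambda]. *)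
Lemma card_le_sup {I U : Type} (nu : I -> cardinal) lambda (A : set U) :
  is_cardinal_sup nu lambda -> (forall i, [set: nu i] #<= A) ->
  [set: lambda] #<= A.
Proof.
move=> [_ lub] nuA; have [//|[a Aa]] := cardinal_le_or A lambda.
have [mu amu] := segment_cardinal a.
have : cardinal_le lambda mu.
  apply: lub => i; apply: card_le_trans (nuA i) (card_le_trans Aa _).
  by move: amu; rewrite card_eq_le => /andP[].
rewrite /cardinal_le -(card_le_eqr amu) => la.
by case: (ord_initial la).
Qed.

End Cardinals.

(** * Consequences of CAP at a single cardinal *)

Lemma CAP_family_CAP (X : topologicalType) (mu : cardinal) :
  CAP X mu -> family_CAP (range (@set1 X)) mu.
Proof.
move=> capX Y Yinj YF.
have /choice[y yE] : forall a, exists y, [set y] = Y a.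
  by move=> a; have [y _ <-] := YF a; exists y.
have yinj : injective y by move=> a b ab; apply: Yinj; rewrite -!yE ab.
have ymu : range y #= [set: mu] by apply: inj_card_eq => a b _ _ /yinj.
have [x xP] := capX _ ymu; exists x => U /xP RU.
apply: card_eq_trans ymu; apply: card_eq_trans RU.
have -> : range y `&` U = y @` [set a | (Y a `&` U) !=set0].
  apply/seteqP; split=> [_ [[a _ <-] Ua]|_ [a [z [+ Uz]] <-]].
    by exists a => //; exists (y a); split=> //; rewrite -yE.
  by rewrite -yE => /= zy; rewrite -zy; split=> //; exists a.
by rewrite card_eq_sym; apply: inj_card_eq => a b _ _ /yinj.
Qed.

(* Either [Y] takes at least [mu] values, and [family_CAP] applies to [mu] of
   them, or some fibre of [Y] has at least [mu] elements; otherwise [lambda]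
   would inject into [mu * mu]. *)
Lemma family_CAP_card_le_nbhs (X : topologicalType) (F : set (set X))
    (mu lambda : cardinal) (Y : lambda -> set X) :
  (forall A : set X, F A -> A !=set0) -> infinite_cardinal mu ->
  cardinal_lt mu lambda -> family_CAP F mu -> (forall a, F (Y a)) ->
  exists x : X, forall U, nbhs x U ->
    [set: mu] #<= [set a | (Y a `&` U) !=set0].
Proof.
move=> Fne mu_inf [_ lambda_mu] capF YF.
have [muY|Ymu] := cardinal_le_total (range Y) mu.
  have /pcard_leP[g] := muY.
  have /choice[h hg] : forall i : mu, exists a, Y a = g i.
    move=> i; have : range Y (g i) by apply: funS.
    by move=> [a _ <-]; exists a.
  have ginj : injective g by move=> i j; apply: (@inj _ _ setT g); rewrite inE.
  have [||x xP] := capF (Y \o h).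
  - by move=> i j /=; rewrite !hg => /ginj.
  - by move=> i /=.
  exists x => U /xP; rewrite card_eq_le => /andP[_ /card_le_trans]; apply.
  apply/card_le_relP; exists (fun i a => h i = a); split.
    by move=> i hU; exists (h i).
  by move=> i j a _ _ <- hji; apply: ginj; rewrite -!hg hji.
have [[A mufib]|nofib] :=
  pselect (exists a, [set: mu] #<= [set b | Y b = Y a]).
  have [x Yx] := Fne _ (YF A); exists x => U /nbhs_singleton Ux.
  apply: card_le_trans mufib (subset_card_le _) => b /= ->.
  by exists x.
case: lambda_mu; apply: card_le_trans (infinite_cardinal_square mu_inf).
have /card_le_relP[P [PY Pinj]] := Ymu.
(* [P] injects the values of [Y] into [mu], and [Q A] injects the fibre over [A]. [Q] is chosen per
   value rather than per index, so that indices in one fibre share the same injection. *)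
have /choice[Q QP] : forall A : set X, exists Q : lambda -> mu -> Prop,
    (forall b, Y b = A -> exists i, Q b i) /\
    (forall b c i, Y b = A -> Y c = A -> Q b i -> Q c i -> b = c).
  move=> A; have [[a <-]|noA] := pselect (exists a, Y a = A).
    have [mufib|/card_le_relP[Q [Q1 Q2]]] :=
        cardinal_le_total [set b | Y b = Y a] mu.
      by case: nofib; exists a.
    by exists Q; split=> // b /Q1[i _]; exists i.
  by exists (fun _ _ => False); split=> b; [move=> Yb; case: noA; exists b|].
apply/card_le_relP; exists (fun a p => P (Y a) p.1 /\ Q (Y a) a p.2); split.
  move=> a _; have [//|i _ Pi] := PY (Y a); have [Q1 _] := QP (Y a).
  by have [//|j Qj] := Q1 a; exists (i, j).
move=> a b [i j] _ _ /= [Pai Qaj] [Pbi Qbj].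
have Yab : Y a = Y b by apply: Pinj Pai Pbi.
rewrite Yab in Qaj; have [_ Q2] := QP (Y b).
exact: Q2 Qaj Qbj.
Qed.

(** * The passage to the singular cardinal *)

Section SingularCAP.
Variables (X : topologicalType) (F : set (set X)) (lambda kappa : cardinal).
Hypothesis F_nonempty : forall A : set X, F A -> A !=set0.
Hypothesis kappaP : is_cf kappa lambda.
Variable lambda_ : kappa -> cardinal.
Hypothesis lambda_infinite : forall b, infinite_cardinal (lambda_ b).
Hypothesis lambda_lt : forall b, cardinal_lt (lambda_ b) lambda.
Hypothesis lambda_sup : is_cardinal_sup lambda_ lambda.

(** Otherwise the image of [D] under [s] is cofinal in [lambda], hence has at least [kappa]
    elements. *)
Lemma card_lt_cf_bounded {I : Type} (D : set I) (s : I -> lambda) :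
  ~ ([set: kappa] #<= D) -> exists t, forall i, D i -> ~~ ord_le t (s i).
Proof.
move=> Dkappa; apply: contrapT => unbounded; apply: Dkappa.
apply: card_le_trans (card_image_le s D); apply: kappaP.2 => a.
apply: contrapT => na; apply: unbounded; exists a => i Di.
by apply/negP => asi; apply: na; exists (s i) => //; exists i.
Qed.

Lemma segment_lt_sup (t : lambda) :
  exists d, ~ ([set: lambda_ d] #<= segment t).
Proof.
apply: contrapT => nd; apply: (@ord_initial _ t).
apply: card_le_sup lambda_sup _.
by move=> d; apply: contrapT => ?; apply: nd; exists d.
Qed.

Lemma cofinal_index (b : kappa) :
  exists d, forall c, ord_le c b -> cardinal_le (lambda_ c) (lambda_ d).
Proof.
have wo := @ord_le_wo kappa; have wol := @ord_le_wo lambda.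
have /choice[s sP] : forall c, exists s : lambda,
    [set: lambda_ c] #<= segment s.
  move=> c; have [le|//] := cardinal_le_or [set: lambda_ c] lambda.
  by case: (lambda_lt c).2.
(* Only the indices strictly below [b] are known to be fewer than [kappa]; [b] itself is handled by
   taking [t] as the larger of [t0] and [s b]. *)
have [t0 t0P] := card_lt_cf_bounded s (@ord_initial kappa b).
have [t tP] : exists t, forall c, ord_le c b -> segment (s c) `<=` segment t.
  have [t [t0t sbt]] : exists t, ord_le t0 t /\ ord_le (s b) t.
    have [h|h] := well_order_total wol t0 (s b).
      by exists (s b); split=> //; apply: well_order_refl.
    by exists t0; split=> //; apply: well_order_refl.
  exists t => c cb; have sct : ord_le (s c) t.
    have [bc|nbc] := boolP (ord_le b c).
      by rewrite (well_order_antisym wo cb bc).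
    apply: (well_order_trans wol _ t0t).
    by apply: (well_order_ltW wol); apply: t0P.
  exact: segment_sub.
have [d dt] := segment_lt_sup t; exists d => c cb.
apply: card_le_trans (sP c) _.
apply: card_le_trans (subset_card_le (tP c cb)) _.
by have [] := cardinal_le_total (segment t) (lambda_ d).
Qed.

Lemma family_CAP_star_singular :
  CAP X kappa -> (forall b, family_CAP F (lambda_ b)) ->
  family_CAP_star F lambda.
Proof.
move=> capX capF Y YF.
pose N (U : set X) := [set a | (Y a `&` U) !=set0].
have /choice[x_ xP] : forall b : kappa, exists x : X, forall U, nbhs x U ->
    forall c, ord_le c b -> [set: lambda_ c] #<= N U.
  move=> b; have [d dP] := cofinal_index b.
  have [x xP] := family_CAP_card_le_nbhs F_nonempty
    (@lambda_infinite d) (lambda_lt d) (capF d) YF.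
  by exists x => U /xP dU c /dP cd; apply: card_le_trans cd dU.
apply: contrapT => noacc.
have /choice[u uP] : forall x : X, exists u : lambda,
    exists2 U, nbhs x U & N U #<= segment u.
  move=> x; apply: contrapT => nou; apply: noacc; exists x => U xU.
  rewrite card_eq_le card_leT /=.
  by have [//|[u Nu]] := cardinal_le_or (N U) lambda; case: nou; exists u, U.
have kappaR : [set: kappa] #<= range x_.
  apply: contrapT => /(card_lt_cf_bounded u)[t tP].
  (* The neighbourhood of [x_ d] given by [uP] meets at least [lambda_ d] terms, yet no more than
     [segment t] has elements. *)
  have [d] := segment_lt_sup t; apply.
  have [U xU NU] := uP (x_ d).
  have dd : ord_le d d by apply: well_order_refl (@ord_le_wo kappa) d.
  apply: card_le_trans (xP d U xU d dd) _; apply: card_le_trans NU _.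
  by apply: subset_card_le; apply: segment_sub;
    apply: (well_order_ltW (@ord_le_wo lambda)); apply: tP; exists d.
have [|x xacc] := capX (range x_).
  by rewrite card_eq_le kappaR andbT; apply: card_image_le.
have [U xU NU] := uP x; apply: (@ord_initial _ (u x)).
apply: card_le_trans NU; apply: card_le_sup lambda_sup _ => c.
(* The interior is used so that [U] is also a neighbourhood of every [x_ b] lying in it. *)
have xV : nbhs x (interior U) by apply: nbhs_interior.
have := xacc _ xV; rewrite card_eq_le => /andP[_ RU].
(* [interior U] contains [kappa] many of the points, and the indices below [c] are too few to
   account for them. *)
have [b cb Ub] : exists2 b, ord_le c b & interior U (x_ b).
  apply: contrapT => nob; apply: (@ord_initial _ c).
  apply: card_le_trans kappaR _; apply: card_le_trans RU _.
  apply: card_le_trans (card_image_le x_ _); apply: subset_card_le.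
  move=> _ [[b _ <-] Ub]; exists b => //=; apply/negP => cb.
  by apply: nob; exists b.
exact: xP Ub _ cb.
Qed.

End SingularCAP.

Unset Implicit Arguments.

Theorem proposition3p5 (X : topologicalType) (F : set (set X))
    (F_nonempty : forall A : set X, F A -> A !=set0)
    (lambda : cardinal) (lambda_singular : singular_cardinal lambda)
    (cf_lambda : cardinal) (cf_lambdaP : is_cf cf_lambda lambda)
    (lambda_ : cf_lambda -> cardinal)
    (lambda_infinite : forall b, infinite_cardinal (lambda_ b))
    (lambda_lt : forall b, cardinal_lt (lambda_ b) lambda)
    (lambda_sup : is_cardinal_sup lambda_ lambda) :
  (CAP X cf_lambda ->
   (forall b, family_CAP F (lambda_ b)) ->
   family_CAP_star F lambda) /\
  (CAP X cf_lambda ->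
   (forall b, CAP X (lambda_ b)) ->
   CAP_star X lambda).
Proof.
split=> [|capX cap_]; first exact: family_CAP_star_singular.
apply: (family_CAP_star_singular _ cf_lambdaP) => // [_ [x _ <-]|b].
  by exists x.
exact: CAP_family_CAP.
Qed.
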